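(* Let $p$ be a prime. Call two polynomials $f(x)$ and $g(x)$ over $\mathbb{Z}/p$ (not zero) similar if $g$ can be obtained from $f$ by a finite sequence of the following transformations: $f(x)\mapsto f(cx)$ and $f(x)\mapsto c f(x)$ for an integer $1<c<p$; $f(x)\mapsto x^c f(x)$ for an integer $c>0$; $f(x)\mapsto f(x^c)$ for an integer $c>1$; $f(x)\mapsto x^{\deg f}f(x^{-1})$; and $f(x)\mapsto f(x)^c$ for an integer $c>1$. Then any two similar polynomials $f,g$ satisfy $\lambda(f)=\lambda(g)$.
   Context: For a polynomial $f$ over $\mathbb{Z}/p$, let $q_f(i)$ be the number of nonzero coefficients of $f(x)^i$ modulo $p$ and $r_f(n)=\sum_{i=0}^{n-1}q_f(i)$. $\lambda(f)$ denotes the Perron–Frobenius (largest positive) eigenvalue of Willson's nonnegative integer transition matrix $B$ associated with $f$ and $p$ (S. Willson's matrix method for linear cellular automata); it governs the growth of the number of nonzero coefficients: $r_f(p^k)$ grows like a constant times $\lambda(f)^k$, i.e. $\log\lambda(f)=\lim_{k\to\infty}\frac{\log r_f(p^k)}{k}$, and $\log_p\lambda(f)$ is the fractal dimension of the associated fractal. *)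

(* Defs.v *)
From HB Require Import structures.
From mathcomp Require Import all_boot all_order all_algebra.
From mathcomp Require Import all_classical all_reals.
From Stdlib Require Export Relation_Operators.

Set Implicit Arguments.
Unset Strict Implicit.
Unset Printing Implicit Defensive.

Import Order.TTheory GRing.Theory Num.Theory.
Local Open Scope ring_scope.

Section Willson.
Variables (p : nat) (f : {poly 'F_p}).

(* Number of consecutive coefficients recorded in a block: deg f, or 1 when f
   is constant. *)
Definition block_len : nat := maxn 1 (size f).-1.

Definition block := 'rV['F_p]_block_len.

(* u is a string of consecutive coefficients of f ^+ n; multiplying by a power
   of 'X pads f ^+ n with zeros on the left, so that strings may overlap its
   low-degree end. *)
Definition occurs_in (n : nat) (u : block) : Prop :=
  exists s : nat,
    forall j : 'I_block_len, u 0 j = ('X^block_len * f ^+ n)`_(s + j).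

Definition accessible_blocks : {set block} :=
  finset (fun u : block => (u != 0) && `[< exists n : nat, occurs_in n u >]).

Definition block_poly (u : block) : {poly 'F_p} :=
  \sum_(j < block_len) u 0 j *: 'X^j.

(* Since f ^+ (p * n + m) = f ^+ m * (f ^+ n \Po 'X^p) over 'F_p, the block of
   f ^+ n whose last entry is the coefficient of 'X^s determines, for each
   m, t < p, the block of f ^+ (p * n + m) whose last entry is the coefficient
   of 'X^(p * s + t).  That block is offspring u m t: it occupies positions
   (p - 1) * (block_len - 1) + t, ..., p * (block_len - 1) + t relative to the
   image of the first entry of u, and no coefficient of f ^+ n outside u
   contributes to these positions because deg f <= block_len. *)
Definition offspring (u : block) (m t : 'I_p) : block :=
  \row_(j < block_len)
    (f ^+ m * (block_poly u \Po 'X^p))`_(p.-1 * block_len.-1 + t + j).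

(* Willson's transition matrix: the entry (u, v) is the number of occurrences
   of v among the p ^ 2 offspring of u. *)
Definition willson_matrix : 'M[nat]_#|accessible_blocks| :=
  \matrix_(i, j)
    #|finset (fun mt : 'I_p * 'I_p =>
        offspring (enum_val i) mt.1 mt.2 == enum_val j)|.

(* The largest positive eigenvalue; the set is finite, and nonempty by the
   Perron-Frobenius theorem, so that sup is a maximum. *)
Definition lambda (R : realType) : R :=
  sup [set x : R | 0 < x /\
        eigenvalue (map_mx (fun n : nat => n%:R : R) willson_matrix) x]%classic.

End Willson.

(* 'X^(deg f) * f('X^-1) *)
Definition reciprocal (R : nzRingType) (f : {poly R}) : {poly R} :=
  \poly_(i < size f) f`_((size f).-1 - i).

Inductive transformation (p : nat) (f : {poly 'F_p}) : {poly 'F_p} -> Prop :=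
| transf_scale_var (c : nat) :
    (1 < c < p)%N -> transformation f (f \Po (c%:R *: 'X))
| transf_scale (c : nat) :
    (1 < c < p)%N -> transformation f (c%:R *: f)
| transf_shift (c : nat) :
    (0 < c)%N -> transformation f ('X^c * f)
| transf_subst_pow (c : nat) :
    (1 < c)%N -> transformation f (f \Po 'X^c)
| transf_reciprocal :
    transformation f (reciprocal f)
| transf_pow (c : nat) :
    (1 < c)%N -> transformation f (f ^+ c).

Definition similar_poly (p : nat) : {poly 'F_p} -> {poly 'F_p} -> Prop :=
  clos_refl_trans {poly 'F_p} (@transformation p).

(* Main.v *)
Require Import Defs.
From HB Require Import structures.
From mathcomp Require Import all_boot all_order all_algebra.
From mathcomp Require Import all_classical all_reals.
From mathcomp Require Import zify ring lra finfield.

Set Implicit Arguments.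
Unset Strict Implicit.
Unset Printing Implicit Defensive.

Import Order.TTheory GRing.Theory Num.Theory.
Local Open Scope ring_scope.

(* Every transformation changes cumulative_support_size f (p ^ k), that is
   r_f(p^k), at most by a bounded factor, so it suffices that the growth rate of
   r_f(p^k) determines lambda f.  The sum of the entries of B ^ k counts the
   nonzero blocks which descend in k steps from accessible blocks.  Since
   f ^ (p ^ k n + m) = f ^ m * f ^ n (X ^ (p ^ k)), this count lies between
   constant multiples of r_f(p^k).  For a nonnegative matrix A, a weak form of the
   Perron-Frobenius theorem concludes: a positive eigenvalue x gives
   x ^ k <= entry_sum (A ^ k), and conversely entry_sum (A ^ k) >= c x ^ k for all
   k forces an eigenvalue y >= x, since otherwise there is a positive w with
   w (x - A) = (1, ..., 1), and then entry_sum (w A ^ k) / x ^ k decreases by at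
   least c / x at each step while remaining nonnegative. *)

(** * Growth of powers of a nonnegative matrix and its positive eigenvalues *)

Definition entry_sum (R : nmodType) (m n : nat) (A : 'M[R]_(m, n)) : R :=
  \sum_i \sum_j A i j.

Definition nonneg_mx (R : numDomainType) (m n : nat) (A : 'M[R]_(m, n)) :=
  forall i j, 0 <= A i j.

(* Collatz-Wielandt certificate: for positive t, t exceeds the Perron eigenvalue
   of A. *)
Definition dominated (R : numDomainType) (n : nat) (A : 'M[R]_n) (t : R) :=
  exists2 w : 'rV[R]_n, forall j, 0 < w 0 j & forall j, (w *m A) 0 j < t * w 0 j.

Lemma entry_sumD (R : nmodType) (m n : nat) (A B : 'M[R]_(m, n)) :
  entry_sum (A + B) = entry_sum A + entry_sum B.
Proof.
rewrite /entry_sum -big_split; apply: eq_bigr => i _.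
by rewrite -big_split; apply: eq_bigr => j _; rewrite mxE.
Qed.

Lemma entry_sumZ (R : pzRingType) (m n : nat) (a : R) (A : 'M[R]_(m, n)) :
  entry_sum (a *: A) = a * entry_sum A.
Proof.
rewrite /entry_sum mulr_sumr; apply: eq_bigr => i _.
by rewrite mulr_sumr; apply: eq_bigr => j _; rewrite mxE.
Qed.

Lemma entry_sum_ge0 (R : numDomainType) (m n : nat) (A : 'M[R]_(m, n)) :
  nonneg_mx A -> 0 <= entry_sum A.
Proof. by move=> A_ge0; rewrite sumr_ge0 // => i _; rewrite sumr_ge0. Qed.

Lemma entry_sum_ones_mul (R : pzRingType) (m n : nat) (A : 'M[R]_(m, n)) :
  entry_sum ((const_mx 1 : 'rV_m) *m A) = entry_sum A.
Proof.
rewrite /entry_sum big_ord1 exchange_big; apply: eq_bigr => j _.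
by rewrite mxE; apply: eq_bigr => i _; rewrite mxE mul1r.
Qed.

Lemma nonneg_mx_mul (R : numDomainType) (m n q : nat) (A : 'M[R]_(m, n))
    (B : 'M[R]_(n, q)) : nonneg_mx A -> nonneg_mx B -> nonneg_mx (A *m B).
Proof. by move=> A0 B0 i j; rewrite mxE sumr_ge0 // => l _; rewrite mulr_ge0. Qed.

Lemma nonneg_mx_exp (R : numDomainType) (n : nat) (A : 'M[R]_n) (k : nat) :
  nonneg_mx A -> nonneg_mx (A ^+ k).
Proof.
move=> A0; elim: k => [|k IHk]; first by move=> i j; rewrite expr0 mxE ler0n.
by rewrite exprS -[_ * _]/(A *m _); apply: nonneg_mx_mul.
Qed.

Lemma mulmx_subr_scalar (R : comPzRingType) (n : nat) (v : 'rV[R]_n)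
    (A : 'M[R]_n) (t : R) : v *m (t%:M - A) = t *: v - v *m A.
Proof. by rewrite mulmxBr mul_mx_scalar. Qed.

(* Minimum principle: at the index minimizing v / w the inequality would fail
   if the minimum were negative. *)
Lemma dominated_inverse_positive (R : realFieldType) (n : nat) (A : 'M[R]_n)
    (t : R) (v : 'rV[R]_n) :
  nonneg_mx A -> dominated A t -> (forall j, (v *m A) 0 j <= t * v 0 j) ->
  forall j, 0 <= v 0 j.
Proof.
move=> A0 [w w0 wA] vA j; rewrite leNgt; apply/negP => vj0.
case: (@arg_minP _ _ _ j predT (fun i => v 0 i / w 0 i)) => // i _ imin.
set m := v 0 i / w 0 i in imin.
have m0 : m < 0.
  by apply: le_lt_trans (imin j isT) _; rewrite pmulr_llt0 // invr_gt0.
have vm k : m * w 0 k <= v 0 k by rewrite -ler_pdivlMr // imin.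
have vi : v 0 i = m * w 0 i by rewrite divfK // gt_eqF.
have : m * (w *m A) 0 i <= (v *m A) 0 i.
  rewrite !mxE mulr_sumr; apply: ler_sum => k _.
  by rewrite mulrA ler_wpM2r.
move/le_trans/(_ (vA i)); rewrite vi mulrCA ler_nM2l // => /(lt_le_trans (wA i)).
by rewrite ltxx.
Qed.

(** The minimum principle, applied to [v] and [- v], shows that a [v] with [v A = t v] vanishes, so
    [t - A] is invertible. The same principle makes the solution nonnegative, and [t w = 1 + w A]
    then makes it positive. *)
Lemma dominated_solution (R : realFieldType) (n : nat) (A : 'M[R]_n) (t : R) :
  nonneg_mx A -> 0 < t -> dominated A t ->
  exists2 w : 'rV[R]_n, forall j, 0 < w 0 j & w *m (t%:M - A) = const_mx 1.
Proof.
move=> A0 t0 domA.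
have unitA : t%:M - A \in unitmx.
  rewrite -row_free_unit; apply: inj_row_free => v; rewrite mulmx_subr_scalar => /eqP.
  rewrite subr_eq0 => /eqP vA; apply/rowP => j; rewrite mxE; apply: le_anti.
  rewrite (@dominated_inverse_positive _ _ A t v) ?andbT //; last first.
    by move=> k; rewrite -vA mxE.
  rewrite -oppr_ge0; have := @dominated_inverse_positive _ _ A t (- v) A0 domA.
  move/(_ _ j); rewrite mxE; apply => k; rewrite mulNmx -vA !mxE.
  by rewrite mulrN.
pose w : 'rV[R]_n := const_mx 1 *m invmx (t%:M - A).
have wE : w *m (t%:M - A) = const_mx 1 by rewrite mulmxKV.
have wEj j : t * w 0 j = 1 + (w *m A) 0 j.
  have := congr1 (fun u : 'rV__ => u 0 j) wE.
  by rewrite mulmx_subr_scalar !mxE => /eqP; rewrite subr_eq => /eqP.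
have w0 : forall j, 0 <= w 0 j.
  by apply: (@dominated_inverse_positive _ _ A t) => // j; rewrite wEj lerDr ler01.
exists w => // j; rewrite -(pmulr_rgt0 _ t0) wEj ltr_wpDr //.
by rewrite mxE sumr_ge0 // => k _; rewrite mulr_ge0.
Qed.

(* The solutions w of w (s - A) = (1, ..., 1) remain bounded as s decreases to a
   t at which t - A is invertible, so that such a w still certifies t - d. *)
Lemma dominated_below (R : realFieldType) (n : nat) (A : 'M[R]_n) (t : R) :
  nonneg_mx A -> 0 < t -> ~~ eigenvalue A t ->
  exists2 d : R, 0 < d &
    forall s, t <= s < t + d -> dominated A s -> dominated A (t - d).
Proof.
move=> A0 t0 tN.
have unitA : t%:M - A \in unitmx.
  rewrite -row_free_unit; apply: inj_row_free => v; rewrite mulmx_subr_scalar => /eqP.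
  rewrite subr_eq0 => /eqP vA; apply/eqP; apply: contraNT tN => vN0.
  by apply/eigenvalueP; exists v.
set S := invmx (t%:M - A).
(* [C] bounds the operator [S]. With [a] the sum of the entries of [w] and
   [e = s - t < d = 1 / (4 C)], the identity [w = (1 - e w) S] gives [a <= 4 C / 3]. Hence
   [(e + d) a <= 2 / 3 < 1], which is what [w] needs to certify [t - d]. *)
pose C := 1 + \sum_i \sum_j `|S i j|.
have C1 : 1 <= C by rewrite lerDl sumr_ge0 // => i _; rewrite sumr_ge0.
have C0 : 0 < C := lt_le_trans ltr01 C1.
have d0 : 0 < (4 * C)^-1 by rewrite invr_gt0 mulr_gt0.
exists (4 * C)^-1 => // s /andP[ts sd] domA.
have s0 : 0 < s := lt_le_trans t0 ts.
have [w w0 wE] := dominated_solution A0 s0 domA.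
set e := s - t; have e0 : 0 <= e by rewrite subr_ge0.
pose a := \sum_j w 0 j.
have a0 : 0 <= a by rewrite sumr_ge0 // => j _; apply: ltW.
have wa j : w 0 j <= a.
  by rewrite /a (bigD1 j) //= lerDl sumr_ge0 // => i _; apply: ltW.
have wS : w = (const_mx 1 - e *: w) *m S.
  rewrite -wE mulmx_subr_scalar /e scalerBl.
  rewrite opprB addrC addrA subrK -mulmx_subr_scalar mulmxK //.
have aC : a <= (1 + e * a) * C.
  have {1}-> : a = \sum_j ((const_mx 1 - e *: w) *m S) 0 j by rewrite -wS.
  clearbody a.
  under eq_bigr do rewrite mxE.
  rewrite exchange_big /= [_ * C]mulrDr mulr1 [_ * \sum_i _]mulr_sumr.
  apply: ler_wpDl; first by rewrite addr_ge0 // mulr_ge0.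
  apply: ler_sum => i _; rewrite mulr_sumr; apply: ler_sum => j _.
  apply: le_trans (ler_norm _) _; rewrite normrM ler_wpM2r // !mxE.
  apply: le_trans (ler_normB _ _) _; rewrite normr1 lerD2l.
  by rewrite ger0_norm ?mulr_ge0 ?(ltW (w0 i)) // ler_wpM2l.
set d := (4 * C)^-1 in d0 sd *.
have ed : e < d by rewrite /e; lra.
have dC : d * C = 4^-1 by rewrite /d invfM mulfVK ?gt_eqF.
have eaC : e * a * C <= a / 4.
  by rewrite mulrAC -dC mulrC ler_wpM2l // ler_wpM2r ?ltW.
have aC2 : a <= 4 / 3 * C by lra.
have eda : (e + d) * a < 1.
  have ea : e * a <= d * a by apply: ler_wpM2r => //; apply: ltW.
  have : d * a <= d * (4 / 3 * C) by apply: ler_wpM2l => //; apply: ltW.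
  by lra.
exists w => // j.
have wAj : (w *m A) 0 j = s * w 0 j - 1.
  have := congr1 (fun u : 'rV__ => u 0 j) wE.
  by rewrite mulmx_subr_scalar !mxE => <-; rewrite opprB addrC subrK.
rewrite wAj ltrBlDr -ltrBlDl -mulrBl.
apply: le_lt_trans eda; have -> : s - (t - d) = e + d by rewrite /e; lra.
by rewrite ler_wpM2l // addr_ge0 // ltW.
Qed.

Lemma dominated_large (R : realFieldType) (n : nat) (A : 'M[R]_n) (t : R) :
  nonneg_mx A -> entry_sum A < t -> dominated A t.
Proof.
move=> A0 tA; exists (const_mx 1) => j; first by rewrite mxE ltr01.
rewrite !mxE mulr1; apply: le_lt_trans tA; apply: ler_sum => i _.
by rewrite mxE mul1r (bigD1 j) //= lerDl sumr_ge0.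
Qed.

(* The infimum of the dominated values above x cannot exceed x, as it would
   otherwise be an eigenvalue by dominated_below. *)
Lemma dominated_above_eigenvalues (R : realType) (n : nat) (A : 'M[R]_n) (x : R) :
  nonneg_mx A -> 0 < x -> (forall y, x <= y -> ~~ eigenvalue A y) ->
  dominated A x.
Proof.
move=> A0 x0 noeig.
pose G : set R := [set t | x <= t /\ dominated A t]%classic.
have lbG : lbound G x by move=> t [].
have G0 : (G !=set0)%classic.
  exists (x + 1 + entry_sum A); have E0 := entry_sum_ge0 A0.
  split; first by lra.
  by apply: dominated_large => //; lra.
have infG : has_inf G by split => //; exists x.
have xinf : x <= inf G by apply: lb_le_inf.
have inf0 : 0 < inf G := lt_le_trans x0 xinf.
have [d d0 dP] := dominated_below A0 inf0 (noeig _ xinf).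
have [s [xs sdom] sd] := inf_adherent d0 infG.
have infs : inf G <= s by apply: ge_inf => //; exists x.
have /dP /(_ sdom) [w w0 wA] : inf G <= s < inf G + d by rewrite infs sd.
have up t : inf G - d <= t -> dominated A t.
  move=> tle; exists w => // j; apply: lt_le_trans (wA j) _.
  by rewrite ler_wpM2r // ltW.
(* Either the certificate for [inf G - d] already covers [x], or [inf G - d] is an element of [G]
   below its infimum. *)
case: (lerP (inf G - d) x) => [/up //|xlt].
have /(ge_inf (proj2 infG)) : G (inf G - d) by split; [exact: ltW|exact: up].
by move=> h; lra.
Qed.

Lemma eigenvalue_of_growth (R : realType) (n : nat) (A : 'M[R]_n) (x c : R) :
  nonneg_mx A -> 0 < x -> 0 < c -> (forall k, c * x ^+ k <= entry_sum (A ^+ k)) ->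
  exists2 y, x <= y & eigenvalue A y.
Proof.
move=> A0 x0 c0 growth; apply: contrapT => noeig.
have noeig' y : x <= y -> ~~ eigenvalue A y.
  by move=> xy; apply/negP => ey; apply: noeig; exists y.
have [w w0 wE] :=
  dominated_solution A0 x0 (dominated_above_eigenvalues A0 x0 noeig').
pose sigma k := entry_sum (w *m A ^+ k).
have sigma0 k : 0 <= sigma k.
  apply: entry_sum_ge0; apply: nonneg_mx_mul; last exact: nonneg_mx_exp.
  by move=> i j; rewrite ord1 ltW.
have sigmaS k : x * sigma k = entry_sum (A ^+ k) + sigma k.+1.
  rewrite /sigma -entry_sumZ -(entry_sum_ones_mul (A ^+ k)) -entry_sumD; congr entry_sum.
  by rewrite -wE mulmx_subr_scalar mulmxBl -scalemxAl exprS -mulmxA subrK.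
have sigma_le k : sigma k <= x ^+ k * (sigma 0 - k%:R * (c / x)).
  elim: k => [|k IHk]; first by rewrite expr0 mul1r mul0r subr0.
  have := sigmaS k; have := growth k; rewrite exprS -natr1 mulrDl mul1r => gk Sk.
  rewrite -(ler_pM2l x0) in IHk.
  have -> : x * x ^+ k * (sigma 0 - (k%:R * (c / x) + c / x)) =
      x * (x ^+ k * (sigma 0 - k%:R * (c / x))) - c * x ^+ k.
    by field; rewrite gt_eqF.
  by lra.
have cx0 : 0 < c / x by rewrite divr_gt0.
(* For [K] with [K c / x > sigma 0] the linear bound [sigma_le] becomes negative. *)
have := archi_boundP (divr_ge0 (sigma0 0%N) (ltW cx0)).
set K := Num.bound _; rewrite ltr_pdivrMr // => Klt.
have := le_trans (sigma0 K) (sigma_le K).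
by rewrite pmulr_rge0 ?exprn_gt0 // subr_ge0 leNgt Klt.
Qed.

(** The eigenvector may have entries of both signs: take absolute values in [v A^k = x^k v], sum
    over the coordinates and divide by the sum [M] of all [|v_j|]. *)
Lemma growth_of_eigenvalue (R : realFieldType) (n : nat) (A : 'M[R]_n) (x : R)
    (k : nat) :
  nonneg_mx A -> 0 < x -> eigenvalue A x -> x ^+ k <= entry_sum (A ^+ k).
Proof.
move=> A0 x0 /eigenvalueP[v vA v0].
have vAk : v *m A ^+ k = x ^+ k *: v.
  elim: k => [|k IHk]; first by rewrite !expr0 mulmx1 scale1r.
  by rewrite exprSr mulmxA IHk -scalemxAl vA scalerA exprSr.
pose M := \sum_j `|v 0 j|.
have vM j : `|v 0 j| <= M by rewrite /M (bigD1 j) //= lerDl sumr_ge0.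
have M0 : 0 < M.
  have /rV0Pn[j vj] := v0.
  by apply: lt_le_trans (vM j); rewrite normr_gt0.
rewrite -(ler_pM2r M0) {1}/M mulr_sumr /entry_sum exchange_big mulr_suml.
apply: ler_sum => j _; have -> : x ^+ k * `|v 0 j| = `|(v *m A ^+ k) 0 j|.
  by rewrite vAk mxE normrM ger0_norm // exprn_ge0 // ltW.
rewrite mxE mulr_suml; apply: le_trans (ler_norm_sum _ _ _) _.
apply: ler_sum => i _; have Ak := nonneg_mx_exp k A0.
by rewrite normrM (ger0_norm (Ak _ _)) mulrC ler_wpM2l.
Qed.

(** Both sets have the same downward closure, and passing to the closure does not change [sup]. *)
Lemma sup_cofinal (R : realType) (A B : set R) :
  (forall x, A x -> exists2 y, x <= y & B y) ->
  (forall x, B x -> exists2 y, x <= y & A y) -> sup A = sup B.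
Proof.
move=> AB BA; rewrite -(sup_down A) -(sup_down B); congr sup.
apply/seteqP; split => x /downP[a Aa xa]; apply/downP.
  by have [b ab Bb] := AB _ Aa; exists b => //; apply: le_trans ab.
by have [b ab Bb] := BA _ Aa; exists b => //; apply: le_trans ab.
Qed.

Lemma eigenvalue_le_of_growth_le (R : realType) (m n : nat) (A : 'M[R]_m)
    (B : 'M[R]_n) (C x : R) :
  nonneg_mx A -> nonneg_mx B -> 0 < C ->
  (forall k, entry_sum (A ^+ k) <= C * entry_sum (B ^+ k)) ->
  0 < x -> eigenvalue A x -> exists2 y, x <= y & eigenvalue B y.
Proof.
move=> A0 B0 C0 AB x0 eigx; apply: (@eigenvalue_of_growth _ _ _ _ C^-1) => //.
  by rewrite invr_gt0.
move=> k; rewrite ler_pdivrMl //; apply: le_trans (AB k).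
exact: growth_of_eigenvalue.
Qed.

(** * Numbers of nonzero coefficients *)

Lemma sum_ord_mul (a b : nat) (F : nat -> nat) :
  (\sum_(i < a * b) F i = \sum_(i < a) \sum_(j < b) F (b * i + j))%N.
Proof.
rewrite -(big_mkord xpredT) big_nat_mul big_mkord; apply: eq_bigr => i _.
rewrite -{1}[(i * b)%N]add0n big_addn mulSn addnK big_mkord.
by apply: eq_bigr => j _; rewrite addnC mulnC.
Qed.

Lemma leq_sum_shift (a b : nat) (F : nat -> nat) :
  (\sum_(j < b) F (a + j) <= \sum_(i < a + b) F i)%N.
Proof. by rewrite big_split_ord /= leq_addl. Qed.

Definition support_size (R : nzSemiRingType) (g : {poly R}) : nat :=
  (\sum_(i < size g) (g`_i != 0)%R)%N.

Section SupportSize.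
Variable R : nzSemiRingType.
Implicit Types g h : {poly R}.

Lemma support_sizeE g (N : nat) :
  (size g <= N)%N -> support_size g = (\sum_(i < N) (g`_i != 0)%R)%N.
Proof.
move=> gN; rewrite /support_size (big_ord_widen N (fun i => (g`_i != 0)%R : nat)) //.
rewrite big_mkcond; apply: eq_bigr => i _.
by case: ltnP => // /leq_sizeP -> //; rewrite eqxx.
Qed.

Lemma sum_support_le g (N : nat) :
  (\sum_(i < N) (g`_i != 0)%R <= support_size g)%N.
Proof.
rewrite (@support_sizeE g (N + size g)) ?leq_addl //.
by rewrite big_split_ord leq_addr.
Qed.

Lemma support_size0 : support_size (0 : {poly R}) = 0%N.
Proof. by rewrite /support_size size_poly0 big_ord0. Qed.

Lemma support_sizeD g h :
  (support_size (g + h)%R <= support_size g + support_size h)%N.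
Proof.
set N := maxn (size g) (size h).
rewrite !(@support_sizeE _ N) ?leq_maxl ?leq_maxr ?size_polyD // -big_split.
apply: leq_sum => i _; rewrite coefD.
have [->|_] := eqVneq g`_i 0; first by rewrite add0r leq_addl.
by apply: leq_trans (leq_b1 _) _; rewrite leq_addr.
Qed.

Lemma support_size_sum (n : nat) (G : 'I_n -> {poly R}) :
  (support_size (\sum_i G i)%R <= \sum_i support_size (G i))%N.
Proof.
elim/big_rec2: _ => [|i b g _ IH]; first by rewrite support_size0.
by apply: leq_trans (support_sizeD _ _) _; rewrite leq_add2l.
Qed.

Lemma support_sizeXnM (n : nat) g : support_size ('X^n * g) = support_size g.
Proof.
rewrite (@support_sizeE _ (n + size g)); last first.
  apply/leq_sizeP => j nj; rewrite coefXnM; case: ifP => // _.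
  by rewrite nth_default // leq_subRL // (leq_trans _ nj) // leq_addr.
rewrite big_split_ord /= big1 ?add0n => [|i _]; last by rewrite coefXnM ltn_ord eqxx.
by apply: eq_bigr => i _; rewrite coefXnM ltnNge leq_addr addKn.
Qed.

Lemma support_sizeZ_le (a : R) g :
  (support_size (a *: g)%R <= (a != 0)%R * support_size g)%N.
Proof.
have [->|a0] := eqVneq a 0; first by rewrite scale0r support_size0.
rewrite mul1n (@support_sizeE _ (size g)) ?size_scale_leq //.
apply: leq_sum => i _; rewrite coefZ.
by have [->|] := eqVneq g`_i 0; rewrite ?mulr0 ?eqxx // leq_b1.
Qed.

(** Expand [g] into monomials: each contributes a shifted multiple of [h], and supports are
    subadditive. *)
Lemma support_sizeM g h :
  (support_size (g * h)%R <= support_size g * support_size h)%N.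
Proof.
rewrite -[g in g * h]coefK poly_def mulr_suml.
apply: leq_trans (support_size_sum _) _; rewrite /support_size big_distrl /=.
apply: leq_sum => i _; rewrite -scalerAl.
by apply: leq_trans (support_sizeZ_le _ _) _; rewrite support_sizeXnM.
Qed.

Lemma support_size_comp_Xn g (n : nat) :
  (0 < n)%N -> support_size (g \Po 'X^n) = support_size g.
Proof.
case: n => // n _; rewrite (@support_sizeE _ (size g * n.+1)); last first.
  by rewrite comp_poly_Xn // size_poly.
rewrite (sum_ord_mul _ _ (fun i => ((g \Po 'X^(n.+1))`_i != 0)%R : nat)).
apply: eq_bigr => i _; rewrite big_ord_recl big1 => [|j _].
  by rewrite addn0 coef_comp_poly_Xn // addn0 dvdn_mulr // mulKn.
by rewrite coef_comp_poly_Xn // dvdn_addr ?dvdn_mulr // gtnNdvd ?eqxx //.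
Qed.

End SupportSize.

Lemma support_sizeZ (R : idomainType) (a : R) (g : {poly R}) :
  a != 0 -> support_size (a *: g) = support_size g.
Proof.
move=> a0; rewrite /support_size size_scale //; apply: eq_bigr => i _.
by rewrite coefZ mulf_eq0 (negPf a0).
Qed.

Definition cumulative_support_size (R : nzSemiRingType) (f : {poly R}) (n : nat) :=
  (\sum_(i < n) support_size (f ^+ i)%R)%N.

(** * Powers of polynomials in characteristic p *)

Section Frobenius.
Variables (p : nat) (p_prime : prime p).
Implicit Types f g : {poly 'F_p}.

(** The Frobenius map is a ring morphism and fixes the constants, since [c ^+ p = c] in ['F_p];
    induct on the Horner form. *)
Lemma expr_prime_comp_Xp f : f ^+ p = f \Po 'X^p.
Proof.
have pX : p \in [pchar {poly 'F_p}] by rewrite pchar_poly pchar_Fp.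
elim/poly_ind: f => [|f c IHf].
  by rewrite comp_poly0 expr0n; case: (p) p_prime.
rewrite -(pFrobenius_autE pX) rmorphD /= !pFrobenius_autE exprMn IHf.
rewrite comp_polyD comp_polyM comp_polyX comp_polyC -rmorphXn /=.
by rewrite -{2}[c]expf_card card_Fp.
Qed.

Lemma expr_prime_pow_comp f (k n : nat) : f ^+ (p ^ k * n) = f ^+ n \Po 'X^(p ^ k).
Proof.
elim: k => [|k IHk]; first by rewrite mul1n comp_polyXr.
rewrite expnS -mulnA mulnC exprM IHk expr_prime_comp_Xp -comp_polyA comp_Xn_poly.
by rewrite -exprM mulnC.
Qed.

Lemma support_size_expr_prime_pow f (k n m : nat) :
  (support_size (f ^+ (p ^ k * n + m))%R <=
    support_size (f ^+ n)%R * support_size (f ^+ m)%R)%N.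
Proof.
rewrite exprD; apply: leq_trans (support_sizeM _ _) _.
by rewrite expr_prime_pow_comp support_size_comp_Xn // expn_gt0 prime_gt0.
Qed.

End Frobenius.

(** * Blocks of the powers of f and their descendants *)

(* The block of g whose last entry is the coefficient of 'X^s. *)
Definition block_at (p : nat) (f g : {poly 'F_p}) (s : nat) : block f :=
  \row_(j < block_len f) ('X^((block_len f).-1) * g)`_(s + j).

Lemma block_len_gt0 (p : nat) (f : {poly 'F_p}) : (0 < block_len f)%N.
Proof. by rewrite leq_max. Qed.

Lemma size_expr_block_len (p : nat) (f : {poly 'F_p}) (m : nat) :
  (size (f ^+ m)%R <= (block_len f * m).+1)%N.
Proof.
apply: leq_trans (size_poly_exp_leq _ _) _.
by rewrite ltnS leq_mul2r leq_maxr orbT.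
Qed.

Section Blocks.
Variables (p : nat) (p_prime : prime p) (f : {poly 'F_p}).
Implicit Types (g : {poly 'F_p}) (u : block f).
Let L := block_len f.

Lemma block_poly_block_at g (s : nat) :
  block_poly (block_at f g s) = take_poly L (drop_poly s ('X^(L.-1) * g)).
Proof.
rewrite /block_poly /take_poly poly_def; apply: eq_bigr => j _.
by rewrite mxE coef_drop_poly addnC.
Qed.

(** Cut the padded power [P] into the coefficients before, inside and after the block. After
    substituting ['X^p] and multiplying by [f ^+ m], the first part ends before the positions that
    are read, and the last part starts after them. *)
Lemma offspring_block_at (n s : nat) (m t : 'I_p) :
  offspring (block_at f (f ^+ n) s) m t =
  block_at f (f ^+ (p * n + m)) (p * s + t).
Proof.
apply/rowP => j; rewrite !mxE block_poly_block_at.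
set P := 'X^(L.-1) * f ^+ n; set D := drop_poly s P.
have L0 : (0 < L)%N := block_len_gt0 f.
have p0 := prime_gt0 p_prime.
have PE : P = take_poly s P + (take_poly L D + drop_poly L D * 'X^L) * 'X^s.
  by rewrite !poly_take_drop.
(* The substitution turns the padding ['X^(L.-1)] into ['X^(p * L.-1)]; the surplus [p.-1 * L.-1] is
   the offset in [offspring]. *)
have PX : P \Po 'X^p = 'X^(p.-1 * L.-1) * ('X^(L.-1) * f ^+ (p * n)).
  rewrite /P comp_polyM comp_Xn_poly -exprM -expr_prime_comp_Xp // -exprM.
  by rewrite mulrA -exprD -mulSnr prednK // [(n * p)%N]mulnC.
have -> : ('X^(L.-1) * f ^+ (p * n + m))`_(p * s + t + j) =
    ((P \Po 'X^p) * f ^+ m)`_(p.-1 * L.-1 + (p * s + t + j)).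
  by rewrite PX -!mulrA [RHS]coefXnM ltnNge leq_addr addKn exprD.
rewrite PE !(comp_polyD, comp_polyM) !comp_Xn_poly -!exprM mulrDl coefD.
(* The part before the block has degree at most [p (s - 1) + L (p - 1)], one less than
   [p s + (p - 1) (L - 1)], the least position read. *)
rewrite [X in _ = X + _]nth_default ?add0r; last first.
  case: (posnP s) => [->|s0].
    by rewrite take_poly0l comp_poly0 mul0r size_poly0.
  apply: leq_trans (size_polyMleq _ _) _.
  have h1 := size_comp_poly_leq (take_poly s P) 'X^p.
  have h2 := size_take_poly s P; have h3 := size_expr_block_len f m.
  rewrite size_polyXn /= in h1.
  rewrite -/L in h3; have hm := ltn_ord m.
  have h4 : ((size (take_poly s P)).-1 * p <= s.-1 * p)%N.
    by rewrite leq_mul2r -!subn1 leq_sub2r ?orbT.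
  have h5 : (L * m <= L * p.-1)%N by rewrite leq_mul2l; lia.
  have e1 : (s.-1 * p + p = p * s)%N by rewrite -mulSnr prednK // mulnC.
  have e2 : (L * p.-1 = p.-1 * L.-1 + p.-1)%N.
    by rewrite -{1}(prednK L0) mulSnr mulnC.
  have {}h1 := leq_trans h1 (h4 : (_.+1 <= _.+1)%N).
  have {}h3 := leq_trans h3 (h5 : (_.+1 <= _.+1)%N).
  move: h1 h3 e1 e2 p0; clear.
  move: (size _) (size _) (s.-1 * p)%N (L * p.-1)%N (p.-1 * L.-1)%N (p * s)%N.
  by move=> *; lia.
have -> : ((take_poly L D \Po 'X^p + (drop_poly L D \Po 'X^p) * 'X^(p * L)) *
    'X^(p * s) * f ^+ m) =
    (f ^+ m * (take_poly L D \Po 'X^p) +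
      f ^+ m * (drop_poly L D \Po 'X^p) * 'X^(p * L)) * 'X^(p * s) by ring.
have -> : (p.-1 * L.-1 + (p * s + t + j) = p * s + (p.-1 * L.-1 + t + j))%N.
  by rewrite -!addnA addnCA.
(* Relative to [p * s], the part after the block starts at [p L], whereas the greatest position read
   is [(p - 1) (L - 1) + (p - 1) + (L - 1) = p L - 1]. *)
rewrite [RHS]coefMXn ltnNge leq_addr addKn coefD [X in _ = _ + X]coefMXn ifT ?addr0 //.
have lt_t := ltn_ord t; have lt_j := ltn_ord j; rewrite -/L in lt_j.
have e1 : (p * L = p.-1 * L.-1 + p.-1 + L)%N.
  by rewrite -{1}(prednK p0) mulSnr -{1}(prednK L0) mulnSr.
rewrite e1 -/L; move: (p.-1 * L.-1)%N lt_t lt_j p0; clear.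
by move: (nat_of_ord t) (nat_of_ord j) => t' j' A; lia.
Qed.

Lemma accessible_blocksP u :
  reflect (u != 0 /\ exists n s : nat, u = block_at f (f ^+ n) s)
    (u \in accessible_blocks f).
Proof.
have L0 : (0 < L)%N := block_len_gt0 f.
have XL : 'X^L = 'X * 'X^(L.-1) :> {poly 'F_p} by rewrite -exprS prednK.
rewrite inE; apply: (iffP andP) => -[u0 uP]; split => //.
  (* [occurs_in] pads by one more zero than [block_at]. The extra position [s = 0] shows only
     padding, hence the zero block; all others shift by one. *)
  move/asboolP: uP => [n [s uE]]; exists n; case: s => [|s] in uE *; last first.
    by exists s; apply/rowP => j; rewrite uE mxE -/L XL -mulrA coefXM.
  exfalso; move/eqP: u0; apply; apply/rowP => j.
  by rewrite uE mxE coefXnM add0n ltn_ord.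
move: uP => [n [s ->]]; apply/asboolP; exists n, s.+1 => j.
by rewrite mxE -/L XL -mulrA coefXM.
Qed.

Lemma offspring0 (m t : 'I_p) : offspring (0 : block f) m t = 0.
Proof.
apply/rowP => j; rewrite !mxE /block_poly big1 => [|i _].
  by rewrite comp_poly0 mulr0 coef0.
by rewrite mxE scale0r.
Qed.

Lemma offspring_accessible u (m t : 'I_p) :
  u \in accessible_blocks f -> offspring u m t != 0 ->
  offspring u m t \in accessible_blocks f.
Proof.
move=> /accessible_blocksP[_ [n [s ->]]] u0; apply/accessible_blocksP; split => //.
by rewrite offspring_block_at; exists (p * n + m)%N, (p * s + t)%N.
Qed.

(** A nonzero coefficient lies in at most [L] blocks, and a nonzero block contains at least one. *)
Lemma sum_blocks_le g (M : nat) :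
  (\sum_(s < M) (block_at f g s != 0)%R <= L * support_size g)%N.
Proof.
apply: (@leq_trans (\sum_(s < M) \sum_(j < L) (('X^(L.-1) * g)`_(s + j) != 0)%R)).
  apply: leq_sum => s _; case: eqP => //= /eqP/rV0Pn[j].
  by rewrite mxE (bigD1 j) //= => ->.
rewrite exchange_big /= -[X in (X * _)%N]card_ord -sum_nat_const.
apply: leq_sum => j _; rewrite -(support_sizeXnM L.-1 g).
apply: leq_trans (sum_support_le _ (j + M)).
under eq_bigr do rewrite addnC.
exact: (leq_sum_shift j M (fun i => (('X^(L.-1) * g)`_i != 0)%R : nat)).
Qed.

(** The last entry of the block at [s] is the coefficient of ['X^s]. *)
Lemma sum_blocks_ge g (M : nat) :
  (size g <= M)%N -> (support_size g <= \sum_(s < M) (block_at f g s != 0)%R)%N.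
Proof.
move=> gM; rewrite (support_sizeE gM); apply: leq_sum => s _.
have [/rowP b0|_] := eqVneq (block_at f g s) 0; last by rewrite leq_b1.
have lt_L : (L.-1 < L)%N by rewrite prednK // block_len_gt0.
have := b0 (Ordinal lt_L); rewrite !mxE /= coefXnM ltnNge leq_addl addnK /= => ->.
by rewrite eqxx.
Qed.

(** Zero blocks have only zero offspring, so testing for zero at the last generation alone still
    counts the paths through accessible blocks, with multiplicity. *)
Fixpoint num_descendants (k : nat) u : nat :=
  if k is k'.+1 then \sum_(m < p) \sum_(t < p) num_descendants k' (offspring u m t)
  else (u != 0)%R.

Lemma num_descendants0 (k : nat) : num_descendants k 0 = 0%N.
Proof.
elim: k => [|k IHk] /=; first by rewrite eqxx.
by rewrite big1 // => m _; rewrite big1 // => t _; rewrite offspring0.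
Qed.

(** Each generation appends one base-p digit to the exponent and one to the position. *)
Lemma num_descendants_block_at (k n s : nat) :
  num_descendants k (block_at f (f ^+ n) s) =
  (\sum_(m < p ^ k) \sum_(t < p ^ k)
    (block_at f (f ^+ (p ^ k * n + m)) (p ^ k * s + t) != 0)%R)%N.
Proof.
elim: k n s => [|k IHk] n s /=.
  by rewrite !big_ord1 /= !mul1n !addn0.
rewrite expnS.
rewrite (sum_ord_mul _ _ (fun m => \sum_(t < p * p ^ k)
  (block_at f (f ^+ (p * p ^ k * n + m)) (p * p ^ k * s + t) != 0)%R)%N).
apply: eq_bigr => m' _.
under [RHS]eq_bigr => m _ do rewrite (sum_ord_mul _ _ (fun t =>
  (block_at f (f ^+ (p * p ^ k * n + (p ^ k * m' + m))) (p * p ^ k * s + t) != 0)%R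
   : nat)).
rewrite [RHS]exchange_big; apply: eq_bigr => t' _ /=.
rewrite offspring_block_at IHk; apply: eq_bigr => m _; apply: eq_bigr => t _.
by rewrite !mulnDr !addnA !mulnA ![(p ^ k * p)%N]mulnC.
Qed.

Lemma num_descendants_le (k n s : nat) :
  (num_descendants k (block_at f (f ^+ n) s) <=
    L * support_size (f ^+ n)%R * cumulative_support_size f (p ^ k))%N.
Proof.
rewrite num_descendants_block_at /cumulative_support_size big_distrr /=.
apply: leq_sum => m _; rewrite -mulnA.
apply: leq_trans (leq_mul (leqnn _) (support_size_expr_prime_pow p_prime _ k _ _)).
apply: leq_trans (sum_blocks_le _ (p ^ k * s + p ^ k)).
exact: (leq_sum_shift _ _ (fun i => (block_at f _ i != 0)%R : nat)).
Qed.

Definition total_descendants (k : nat) : nat :=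
  \sum_(i < #|accessible_blocks f|) num_descendants k (enum_val i).

(** The descendants of the first [L] blocks of [f ^+ 0] are the blocks of all [f ^+ m] with
    [m < p ^ k] at positions below [L * p ^ k]. This range exceeds the degree of [f ^+ m], so every
    nonzero coefficient is seen. *)
Lemma cumulative_support_size_le (k : nat) :
  (cumulative_support_size f (p ^ k) <= L * total_descendants k)%N.
Proof.
have L0 : (0 < L)%N := block_len_gt0 f.
apply: (@leq_trans (\sum_(s < L) num_descendants k (block_at f (f ^+ 0) s))).
  under [leqRHS]eq_bigr do rewrite num_descendants_block_at muln0.
  rewrite exchange_big /=; apply: leq_sum => m _.
  rewrite -(sum_ord_mul _ _ (fun s => (block_at f (f ^+ m) s != 0)%R : nat)).
  apply: sum_blocks_ge; apply: leq_trans (size_expr_block_len f m) _.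
  by have := ltn_ord m; rewrite -/L -(ltn_pmul2l L0) => /leq_trans; apply.
rewrite -[X in (_ <= X * _)%N]card_ord -sum_nat_const; apply: leq_sum => s _.
have [->|u0] := eqVneq (block_at f (f ^+ 0) s) 0; first by rewrite num_descendants0.
have u_acc : block_at f (f ^+ 0) s \in accessible_blocks f.
  by apply/accessible_blocksP; split => //; exists 0%N, s.
rewrite /total_descendants (bigD1 (enum_rank_in u_acc (block_at f (f ^+ 0) s))) //=.
by rewrite enum_rankK_in // leq_addr.
Qed.

(** An occurrence of each accessible block in some [f ^+ n] yields a constant for that block; there
    are finitely many blocks, so the constants can be added. *)
Lemma total_descendants_le :
  exists C : nat, forall k : nat,
    (total_descendants k <= C * cumulative_support_size f (p ^ k))%N.
Proof.
have : forall i : 'I_#|accessible_blocks f|, exists C : nat, forall k : nat,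
    (num_descendants k (enum_val i) <= C * cumulative_support_size f (p ^ k))%N.
  move=> i; have /accessible_blocksP[_ [n [s ->]]] := enum_valP i.
  by exists (L * support_size (f ^+ n)%R)%N => k; apply: num_descendants_le.
move=> /fin_all_exists[C CP]; exists (\sum_i C i)%N => k.
by rewrite big_distrl /=; apply: leq_sum.
Qed.

(** Induct on the first generation: a nonzero offspring is exactly one accessible block, while a
    zero offspring is counted by no column and has no nonzero descendants. *)
Lemma willson_matrix_exp_row (R : pzRingType) (k : nat) i :
  ((map_mx (fun n : nat => n%:R : R) (willson_matrix f)) ^+ k *m
    (const_mx 1 : 'cV_#|accessible_blocks f|)) i 0 =
  (num_descendants k (enum_val i))%:R.
Proof.
set A := map_mx _ _.
elim: k i => [|k IHk] i.
  have /accessible_blocksP[u0 _] := enum_valP i.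
  by rewrite expr0 mul1mx mxE /= u0.
rewrite exprS -mulmxA mxE /=.
under eq_bigr => j _ do rewrite IHk !mxE -natrM -sum1_card big_distrl /=.
rewrite -natr_sum; congr (_%:R).
under eq_bigr => j _ do rewrite big_mkcond /=.
rewrite exchange_big [RHS]pair_big /=; apply: eq_bigr => -[m t] _ /=.
under eq_bigr => j _ do rewrite inE /= mul1n.
have [u0|u0] := eqVneq (offspring (enum_val i) m t) 0.
  rewrite u0 num_descendants0 big1 // => j _.
  by case: eqP => // <-; rewrite num_descendants0.
have u_acc := offspring_accessible (enum_valP i) u0.
rewrite (bigD1 (enum_rank_in u_acc (offspring (enum_val i) m t))) //=.
rewrite enum_rankK_in // eqxx big1 ?addn0 // => j jN.
case: eqP => // ujE; case/eqP: jN; apply: enum_val_inj.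
by rewrite enum_rankK_in.
Qed.

Lemma entry_sum_willson_matrix (R : pzRingType) (k : nat) :
  entry_sum ((map_mx (fun n : nat => n%:R : R) (willson_matrix f)) ^+ k) =
  (total_descendants k)%:R.
Proof.
rewrite /entry_sum natr_sum; apply: eq_bigr => i _.
rewrite -willson_matrix_exp_row mxE; apply: eq_bigr => j _.
by rewrite mxE mulr1.
Qed.

End Blocks.

(** * From growth rates to lambda *)

Definition growth_le (p : nat) (f g : {poly 'F_p}) : Prop :=
  exists C : nat, forall k : nat,
    (cumulative_support_size f (p ^ k) <= C * cumulative_support_size g (p ^ k))%N.

Lemma growth_le_refl (p : nat) (f : {poly 'F_p}) : growth_le f f.
Proof. by exists 1%N => k; rewrite mul1n. Qed.

Lemma growth_le_trans (p : nat) (g f h : {poly 'F_p}) :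
  growth_le f g -> growth_le g h -> growth_le f h.
Proof.
move=> [C fg] [D gh]; exists (C * D)%N => k; apply: leq_trans (fg k) _.
by rewrite -mulnA leq_mul2l gh orbT.
Qed.

Lemma eigenvalue_willson_growth_le (R : realType) (p : nat) (f g : {poly 'F_p})
    (x : R) :
  prime p -> growth_le f g -> 0 < x ->
  eigenvalue (map_mx (fun n : nat => n%:R : R) (willson_matrix f)) x ->
  exists2 y, x <= y &
    eigenvalue (map_mx (fun n : nat => n%:R : R) (willson_matrix g)) y.
Proof.
move=> p_prime [C fg]; have [D Df] := total_descendants_le p_prime f.
have nonneg (h : {poly 'F_p}) :
  nonneg_mx (map_mx (fun n : nat => n%:R : R) (willson_matrix h)).
  by move=> i j; rewrite mxE ler0n.
(* The constant combines the bounds of descendants of [f] by its supports, of these by the supports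
   of [g], and of those by descendants of [g]; the successor makes it positive. *)
apply: (@eigenvalue_le_of_growth_le _ _ _ _ _ (D * (C * block_len g)).+1%:R) => // k.
rewrite !entry_sum_willson_matrix // -natrM ler_nat.
apply: leq_trans (Df k) _.
apply: (@leq_trans (D * (C * block_len g) * total_descendants g k)).
  rewrite -!mulnA leq_mul2l; apply/orP; right; apply: leq_trans (fg k) _.
  by rewrite leq_mul2l cumulative_support_size_le ?orbT.
by rewrite leq_mul2r leqnSn orbT.
Qed.

Lemma lambda_growth (R : realType) (p : nat) (f g : {poly 'F_p}) :
  prime p -> growth_le f g -> growth_le g f -> lambda f R = lambda g R.
Proof.
move=> p_prime fg gf; apply: sup_cofinal => x [x0 /= eigx].
  have [y xy eigy] := eigenvalue_willson_growth_le p_prime fg x0 eigx.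
  by exists y => //; split => //; apply: lt_le_trans xy.
have [y xy eigy] := eigenvalue_willson_growth_le p_prime gf x0 eigx.
by exists y => //; split => //; apply: lt_le_trans xy.
Qed.

(** * Effect of the transformations on the growth rate *)

Lemma support_size_comp_scale (R : idomainType) (a : R) (g : {poly R}) :
  a != 0 -> support_size (g \Po (a *: 'X)) = support_size g.
Proof.
move=> a0; have coef_scaled i : (g \Po (a *: 'X))`_i = g`_i * a ^+ i.
  rewrite coef_comp_poly; under eq_bigr do rewrite exprZn coefZ coefXn.
  case: (ltnP i (size g)) => [ig|gi].
    rewrite (bigD1 (Ordinal ig)) //= eqxx mulr1 big1 ?addr0 // => j.
    by rewrite -val_eqE eq_sym /= => /negPf ->; rewrite !mulr0.
  rewrite nth_default // mul0r big1 // => j _.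
  by rewrite gtn_eqF ?mulr0 // (leq_trans (ltn_ord j)).
rewrite (@support_sizeE _ _ (size g)); last first.
  by apply/leq_sizeP => i gi; rewrite coef_scaled nth_default ?mul0r.
by apply: eq_bigr => i _; rewrite coef_scaled mulf_eq0 expf_eq0 (negPf a0) andbF orbF.
Qed.

(* 'X^d * g('X^-1), for any bound d on the degree of g. *)
Definition reverse_poly (R : nzRingType) (d : nat) (g : {poly R}) : {poly R} :=
  \poly_(i < d.+1) g`_(d - i).

Lemma reverse_polyE (R : nzRingType) (d : nat) (g : {poly R}) :
  reverse_poly d g = \sum_(i < d.+1) g`_i *: 'X^(d - i).
Proof.
rewrite /reverse_poly poly_def (reindex_inj rev_ord_inj) /=; apply: eq_bigr => i _.
by rewrite subSS subKn // -ltnS.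
Qed.

Lemma coef_widen_poly (R : nzRingType) (d : nat) (g : {poly R}) :
  (size g <= d.+1)%N -> g = \sum_(i < d.+1) g`_i *: 'X^i.
Proof.
move=> gd; rewrite -poly_def; apply/polyP => i; rewrite coef_poly.
by case: ltnP => // di; rewrite nth_default // (leq_trans gd).
Qed.

Lemma reverse_poly_sum (R : nzRingType) (d n : nat) (G : 'I_n -> {poly R}) :
  reverse_poly d (\sum_i G i) = \sum_i reverse_poly d (G i).
Proof.
apply/polyP => i; rewrite coef_sum coef_poly coef_sum.
case: ifP => id; last by rewrite big1 // => j _; rewrite coef_poly id.
by apply: eq_bigr => j _; rewrite coef_poly id.
Qed.

Lemma reverse_polyZXn (R : nzRingType) (d n : nat) (a : R) :
  (n <= d)%N -> reverse_poly d (a *: 'X^n) = a *: 'X^(d - n).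
Proof.
move=> nd; apply/polyP => i; rewrite coef_poly !coefZ !coefXn ltnS.
case: leqP => id; first by congr (_ * _%:R); congr nat_of_bool; lia.
by rewrite gtn_eqF ?mulr0 // (leq_ltn_trans (leq_subr _ _)).
Qed.

(** By bilinearity it suffices to treat monomials, where the complementary exponents [a - i] and
    [b - j] add up to [a + b - (i + j)]. *)
Lemma reverse_polyM (R : comNzRingType) (a b : nat) (g h : {poly R}) :
  (size g <= a.+1)%N -> (size h <= b.+1)%N ->
  reverse_poly (a + b) (g * h) = reverse_poly a g * reverse_poly b h.
Proof.
move=> ga hb; rewrite {1}(coef_widen_poly ga) {1}(coef_widen_poly hb).
rewrite [reverse_poly a g]reverse_polyE [reverse_poly b h]reverse_polyE.
rewrite mulr_suml reverse_poly_sum mulr_suml; apply: eq_bigr => i _.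
rewrite mulr_sumr reverse_poly_sum mulr_sumr; apply: eq_bigr => j _.
rewrite -scalerAl -scalerAr scalerA -exprD reverse_polyZXn; last first.
  by rewrite leq_add // -ltnS.
rewrite -scalerAl -scalerAr scalerA -exprD; congr (_ *: 'X^_).
by have := ltn_ord i; have := ltn_ord j; lia.
Qed.

Lemma reverse_polyX (R : comNzRingType) (a n : nat) (g : {poly R}) :
  (size g <= a.+1)%N -> reverse_poly (a * n) (g ^+ n) = reverse_poly a g ^+ n.
Proof.
move=> ga; elim: n => [|n IHn].
  rewrite muln0 !expr0; apply/polyP => i.
  by rewrite coef_poly coef1 sub0n ltnS leqn0 coef1 eqxx; case: eqP.
rewrite mulnS !exprS reverse_polyM // ?IHn //.
apply: leq_trans (size_poly_exp_leq _ _) _.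
by rewrite ltnS leq_mul2r; case: (size g) ga => [|s] /= sa; apply/orP; right.
Qed.

Lemma support_size_reverse_poly (R : nzRingType) (d : nat) (g : {poly R}) :
  (size g <= d.+1)%N -> support_size (reverse_poly d g) = support_size g.
Proof.
move=> gd; rewrite (support_sizeE gd) (support_sizeE (size_poly _ _)).
rewrite (reindex_inj rev_ord_inj) /=; apply: eq_bigr => i _.
by rewrite coef_poly subSS ltnS leq_subr subKn // -ltnS.
Qed.

Lemma support_size_reciprocal_exp (R : comNzRingType) (f : {poly R}) (i : nat) :
  support_size (reciprocal f ^+ i) = support_size (f ^+ i).
Proof.
have [->|f0] := eqVneq f 0; first by rewrite /reciprocal size_poly0 poly_def big_ord0.
have fS : (size f).-1.+1 = size f by rewrite prednK // lt0n size_poly_eq0.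
have -> : reciprocal f = reverse_poly (size f).-1 f by rewrite /reverse_poly fS.
rewrite -reverse_polyX ?fS // support_size_reverse_poly //.
exact: size_poly_exp_leq.
Qed.

Lemma growth_le_of_support_size (p : nat) (f g : {poly 'F_p}) :
  (forall i, support_size (f ^+ i) = support_size (g ^+ i)) -> growth_le f g.
Proof. by move=> fg; exists 1%N => k; rewrite mul1n leq_sum // => i _; rewrite fg. Qed.

Lemma cumulative_support_size_expr (R : nzSemiRingType) (f : {poly R}) (c n : nat) :
  (0 < c)%N ->
  (cumulative_support_size (f ^+ c) n <= cumulative_support_size f (n * c))%N.
Proof.
case: c => // c _; rewrite /cumulative_support_size.
rewrite (sum_ord_mul _ _ (fun i => support_size (f ^+ i))); apply: leq_sum => i _.
by rewrite big_ord_recl addn0 exprM leq_addr.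
Qed.

(** The exponents [c i] with [i < p ^ k] lie below [c * p ^ k], and each number below that bound is
    [p ^ k * i + m] with [i < c]; the Frobenius bound then costs only a factor
    [support_size (f ^+ i)]. *)
Lemma growth_le_expr (p : nat) (f : {poly 'F_p}) (c : nat) :
  prime p -> (0 < c)%N -> growth_le (f ^+ c) f.
Proof.
move=> p_prime c0; exists (\sum_(i < c) support_size (f ^+ i)%R)%N => k.
apply: leq_trans (cumulative_support_size_expr _ _ c0) _.
rewrite mulnC /cumulative_support_size.
rewrite (sum_ord_mul _ _ (fun i => support_size (f ^+ i))) big_distrl /=.
apply: leq_sum => i _; rewrite big_distrr /=; apply: leq_sum => m _.
exact: support_size_expr_prime_pow.
Qed.

(* Each exponent below c * p ^ k is some c * i + r with r < c, and multiplying
   by f ^+ r enlarges the support at most by the factor support_size (f ^+ r). *)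
Lemma growth_ge_expr (p : nat) (f : {poly 'F_p}) (c : nat) :
  (0 < c)%N -> growth_le f (f ^+ c).
Proof.
move=> c0; exists (\sum_(r < c) support_size (f ^+ r)%R)%N => k.
apply: (@leq_trans (cumulative_support_size f (p ^ k * c))).
  rewrite /cumulative_support_size.
  have -> : (p ^ k * c = p ^ k + (p ^ k * c - p ^ k))%N by rewrite subnKC ?leq_pmulr.
  by rewrite big_split_ord leq_addr.
rewrite /cumulative_support_size.
rewrite (sum_ord_mul _ _ (fun i => support_size (f ^+ i))) mulnC big_distrl /=.
apply: leq_sum => i _; rewrite big_distrr /=; apply: leq_sum => r _.
by rewrite exprD exprM support_sizeM.
Qed.

(** Every transformation except the power preserves the support size of each [f ^+ i]; the power is
    compared in both directions up to constants. *)
Lemma transformation_growth (p : nat) (f g : {poly 'F_p}) :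
  prime p -> transformation f g -> growth_le f g /\ growth_le g f.
Proof.
move=> p_prime fg.
have same_support : (forall i, support_size (g ^+ i) = support_size (f ^+ i)) ->
    growth_le f g /\ growth_le g f.
  by move=> gf; split; apply: growth_le_of_support_size => i.
have natr_neq0 c : (1 < c < p)%N -> c%:R != 0 :> 'F_p.
  move=> /andP[c1 cp]; rewrite -(dvdn_pcharf (pchar_Fp p_prime)) gtnNdvd //.
  exact: ltnW.
case: g / fg same_support => [c cp|c cp|c c0|c c1||c c1] same_support.
- apply: same_support => i.
  by rewrite -(rmorphXn (comp_poly _)) support_size_comp_scale // natr_neq0.
- apply: same_support => i.
  by rewrite exprZn support_sizeZ // expf_neq0 // natr_neq0.
- by apply: same_support => i; rewrite exprMn -exprM support_sizeXnM.
- apply: same_support => i.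
  by rewrite -(rmorphXn (comp_poly _)) support_size_comp_Xn // ltnW.
- by apply: same_support => i; apply: support_size_reciprocal_exp.
- by split; [apply: growth_ge_expr|apply: growth_le_expr] => //; apply: ltnW.
Qed.

Lemma similar_poly_growth (p : nat) (f g : {poly 'F_p}) :
  prime p -> similar_poly f g -> growth_le f g /\ growth_le g f.
Proof.
move=> p_prime; elim=> {f g} [f g|f|f g h _ [fg gf] _ [gh hg]].
- exact: transformation_growth.
- by split; apply: growth_le_refl.
- by split; apply: (@growth_le_trans _ g).
Qed.

Theorem theorem3p6 (R : realType) (p : nat) (p_prime : prime p)
    (f g : {poly 'F_p}) (f_neq0 : f != 0) (g_neq0 : g != 0)
    (f_sim_g : similar_poly f g) :
  lambda f R = lambda g R.
Proof.
have [fg gf] := similar_poly_growth p_prime f_sim_g.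
exact: lambda_growth.
Qed.
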